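(* Consider the FAS-aided wireless powered NOMA communication network described in the context. The outage probability $P_{\mathrm{out},u_2}=\Pr(\gamma_{u_2}\le\hat\gamma_{u_2})$ of the weak FAS-equipped user $u_2$ is given by $$P_{\mathrm{out},u_2}=\Phi_{\mathbf R_{u_2}}(q,\dots,q;\vartheta_2),\qquad q=\sqrt2\,\mathrm{erf}^{-1}\!\Big(1-4\sqrt{\tilde\gamma_{u_2}}\,\mathcal K_1\big(2\sqrt{\tilde\gamma_{u_2}}\big)\Big),$$ where $q$ is repeated $N_{u_2}$ times and $$\tilde\gamma_{u_2}=\frac{\hat\gamma_{u_2}\,d_t^{\alpha}d_{u_2}^{\alpha}}{\overline\gamma L_p\,(p_{u_2}-\hat\gamma_{u_2}p_{u_1})}.$$
   Context: Parameters: $\overline\gamma$ is the average SNR (transmit power of the power beacon divided by the noise variance), $L_p$ is the frequency-dependent propagation loss, $\alpha>2$ is the path-loss exponent, $d_t$ and $d_{u_2}$ are the distances from the power beacon to the transmitter and from the transmitter to user $u_2$, and $p_{u_1},p_{u_2}$ are the NOMA power allocation factors of the strong user $u_1$ and the weak user $u_2$, with $p_{u_1}+p_{u_2}=1$. $\hat\gamma_{u_2}$ is the SINR threshold for $\gamma_{u_2}$ (defined below). $\mathcal K_1$ is the first-order modified Bessel function of the second kind, and $\mathrm{erf}^{-1}$ is the inverse error function. Fluid antenna system (FAS) of user $i$ (here $i=u_2$): a planar grid of $N_i=N_i^1\times N_i^2$ ports, where $N_i^l$ ports are uniformly distributed along a length $W_i^l\lambda$ ($l=1,2$, $\lambda$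 the wavelength). Ports are indexed by $n\in\{1,\dots,N_i\}$ through a fixed bijection $n\mapsto(n^1,n^2)\in\{1,\dots,N_i^1\}\times\{1,\dots,N_i^2\}$. The correlation matrix $\mathbf R_i=(\varrho^i_{n,\tilde n})_{1\le n,\tilde n\le N_i}$ has entries $$\varrho^i_{n,\tilde n}=j_0\!\left(2\pi\sqrt{\Big(\tfrac{n^1-\tilde n^1}{N_i^1-1}W_i^1\Big)^2+\Big(\tfrac{n^2-\tilde n^2}{N_i^2-1}W_i^2\Big)^2}\right),$$ with $j_0$ the zero-order spherical Bessel function of the first kind. $\Phi_{\mathbf R_i}(\cdot;\vartheta)$ denotes the joint CDF of the $N_i$-dimensional normal distribution with zero mean vector and correlation matrix $\mathbf R_i$; $\vartheta$ (written $\vartheta_2$ for user $u_2$) is the dependence parameter of the Gaussian copula, which is identified (as an approximation) with the port covariances $\varrho^i_{n,\tilde n}$, so that it carries no information beyond $\mathbf R_i$. Channel model: the equivalent channel gain $g^{n}_{\mathrm{eq},i}$ at port $n$ is the product of the energy-link gain and the information-link gain, which are independent exponential random variables of unit mean (Rayleigh fading). The joint distribution of $(g^1_{\mathrm{eq},i},\dots,g^{N_i}_{\mathrm{eq},i})$ is modelled by the Gaussian copula: with $F_{n}$ the CDF of $g^n_{\mathrm{eq},i}$ and $\phi^{-1}(u)=\sqrt2\,\mathrm{erf}^{-1}(2u-1)$ the standard normal quantile function, $\Pr(g^1_{\mathrm{eq},i}\le r,\dots,g^{N_i}_{\mathrm{eq},i}\le r)=\Phi_{\mathbf R_i}(\phi^{-1}(F_1(r)),\dots,\phi^{-1}(F_{N_i}(r));\vartheta)$.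 Only the best port is activated, so the channel gain of user $i$ is $g_{\mathrm{fas},i}=\max\{g^1_{\mathrm{eq},i},\dots,g^{N_i}_{\mathrm{eq},i}\}$. The SINR at the weak user $u_2$, which decodes its own signal treating interference as noise, is $$\gamma_{u_2}=\frac{\overline\gamma p_{u_2}L_pd_t^{-\alpha}d_{u_2}^{-\alpha}g_{\mathrm{fas},u_2}}{\overline\gamma p_{u_1}L_pd_t^{-\alpha}d_{u_2}^{-\alpha}g_{\mathrm{fas},u_2}+1}.$$
   Formalization: The formal theorem assumes that the SINR threshold is positive and that p_{u_2} exceeds the threshold times p_{u_1}; otherwise the formula for q is undefined (γ̃ is zero, negative or a division by zero). *)

(* Defs.v *)
From mathcomp Require Import all_boot all_order all_algebra.
From mathcomp Require Import all_classical all_reals all_analysis.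
Set Implicit Arguments.
Unset Strict Implicit.
Unset Printing Implicit Defensive.
Import Order.TTheory GRing.Theory Num.Theory.
Import numFieldNormedType.Exports.
Local Open Scope classical_set_scope.
Local Open Scope ring_scope.

Definition sph_bessel_j0 (R : realType) (x : R) : R :=
  if x == 0 then 1 else sin x / x.

Definition cosh (R : realType) (t : R) : R := (expR t + expR (- t)) / 2.

(* Modified Bessel function of the second kind of order nu, for x > 0, by its
   classical integral representation. *)
Definition besselK (R : realType) (nu x : R) : R :=
  \int[@lebesgue_measure R]_(t in `[0%R, +oo[) (expR (- x * cosh t) * cosh (nu * t)).

(* The oriented integral of exp (- t^2) from 0 to x: at most one of the two
   integrals below is nonzero, depending on the sign of x. *)
Definition erf (R : realType) (x : R) : R :=
  2 / Num.sqrt pi * ((\int[@lebesgue_measure R]_(t in `[0%R, x]) gauss_fun t)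
                     - (\int[@lebesgue_measure R]_(t in `[x, 0%R]) gauss_fun t)).

(* erf is a bijection from R onto ]-1, 1[; erf_inv is meaningful only there. *)
Definition erf_inv (R : realType) (y : R) : R := xget 0 [set x | erf x = y].

Definition normal_quantile (R : realType) (u : R) : R :=
  Num.sqrt 2 * erf_inv (2 * u - 1).

(* The integral of f >= 0 over the orthant prod_k ]-oo, x_k] of R^n, as an
   iterated Lebesgue integral. *)
Fixpoint orthant_integral (R : realType) (n : nat) :
    ('rV[R]_n -> \bar R) -> 'rV[R]_n -> \bar R :=
  match n with
  | 0 => fun f _ => f 0
  | m.+1 => fun f x =>
      (\int[@lebesgue_measure R]_(t in `]-oo, x ord0 ord0])
         orthant_integral (fun y : 'rV[R]_m => f (row_mx (t%:M : 'rV_1) y))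
                          (rsubmx (x : 'rV[R]_(1 + m))))%E
  end.

Definition mvn_pdf (R : realType) (n : nat) (S : 'M[R]_n) (y : 'rV[R]_n) : R :=
  expR (- (y *m invmx S *m y^T) ord0 ord0 / 2)
  / Num.sqrt ((2 * pi) ^+ n * \det S).

(* Joint CDF of the normal law with zero mean and (positive definite)
   covariance matrix S. *)
Definition mvn_cdf (R : realType) (n : nat) (S : 'M[R]_n) (x : 'I_n -> R) : \bar R :=
  orthant_integral (fun y => (mvn_pdf S y)%:E) (\row_k x k).

Definition independent_RV d (T : measurableType d) (R : realType)
    (P : probability T R) (X Y : {RV P >-> R}) : Prop :=
  forall A B : set R, measurable A -> measurable B ->
    P (X @^-1` A `&` Y @^-1` B) = (P (X @^-1` A) * P (Y @^-1` B))%E.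

Definition has_law d (T : measurableType d) (R : realType)
    (P : probability T R) (X : {RV P >-> R}) (mu : set R -> \bar R) : Prop :=
  forall A : set R, measurable A -> distribution P X A = mu A.

(* Ports and grid coordinates are counted from 0, which does not affect the
   coordinate differences.  A one-port side (N = 1) contributes 0 / 0 = 0. *)
Definition port_corr (R : realType) (N1 N2 : nat) (W1 W2 : R)
    (port : 'I_(N1 * N2) -> 'I_N1 * 'I_N2) : 'M[R]_(N1 * N2) :=
  \matrix_(n, m) sph_bessel_j0 (2 * pi * Num.sqrt (
     (((port n).1%:R - (port m).1%:R) / (N1%:R - 1) * W1) ^+ 2 +
     (((port n).2%:R - (port m).2%:R) / (N2%:R - 1) * W2) ^+ 2)).

(* The largest of the g n; the initial value of the iterated maximum is one of
   the g n as soon as 0 < N. *)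
Definition best_gain (R : realType) (N : nat) (g : 'I_N -> R) : R :=
  \big[Num.max/head 0 (codom g)]_(n < N) g n.

(* Gaussian copula with correlation matrix S, on the diagonal (r, ..., r).  Only
   r > 0 is concerned: there the marginal CDFs of the (almost surely positive)
   gains lie in ]0, 1[; for r <= 0 the quantiles are -oo and both sides vanish. *)
Definition gaussian_copula_diag d (T : measurableType d) (R : realType)
    (P : probability T R) (N : nat) (S : 'M[R]_N)
    (g : 'I_N -> {RV P >-> R}) : Prop :=
  forall r : R, 0 < r ->
    P [set w | forall n, g n w <= r] =
    mvn_cdf S (fun n => normal_quantile (fine (cdf (g n) r))).

Definition sinr_weak (R : realType) (snr Lp alpha dt d2 p1 p2 g : R) : R :=
  (snr * p2 * Lp * dt `^ (- alpha) * d2 `^ (- alpha) * g)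
  / (snr * p1 * Lp * dt `^ (- alpha) * d2 `^ (- alpha) * g + 1).

Definition gamma_tilde (R : realType) (snr Lp alpha dt d2 p1 p2 thr : R) : R :=
  (thr * dt `^ alpha * d2 `^ alpha) / (snr * Lp * (p2 - thr * p1)).

(* Main.v *)
Require Import Defs.
From HB Require Import structures.
From mathcomp Require Import all_boot all_order all_algebra.
From mathcomp Require Import ring lra.
From mathcomp Require Import all_classical all_reals all_analysis measurable_realfun.
Set Implicit Arguments.
Unset Strict Implicit.
Unset Printing Implicit Defensive.
Import Order.TTheory GRing.Theory Num.Theory.
Import numFieldNormedType.Exports.
Local Open Scope classical_set_scope.
Local Open Scope ring_scope.

(* The SINR is increasing in a nonnegative gain, so outage means that every port
   gain is at most gamma_tilde, up to the null event that some gain is negative;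
   the copula then reduces the theorem to the CDF of a product XY of two
   independent unit exponentials.  Fubini gives
   P(XY > r) = int_0^oo exp(-y - r/y) dy, and y = sqrt r e^t turns this into
   2 sqrt r K_1(2 sqrt r). *)

(** * Exponential change of variables on the half-line *)

Section exp_substitution.
Context {R : realType}.
Notation mu := (@lebesgue_measure R).
Implicit Types (f : R -> R) (s : R).

Lemma is_derive_scaled_exp s (t : R) :
  is_derive t 1 (fun u => s * expR u) (s * expR t).
Proof. by apply: is_derive_eq; rewrite /GRing.scale/= ?mulr0 ?addr0 ?mulr1. Qed.

Lemma continuous_scaled_exp s : continuous (fun u : R => s * expR u).
Proof. by move=> t; apply: cvgMl_tmp; exact: continuous_expR. Qed.

(** The map [s * expR t] is an increasing bijection from the line onto the open half-line and is its
    own derivative, hence the Jacobian factor [s * expR t]. Nonnegativity of [f] lets both sides be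
    infinite. *)
Lemma ge0_integral_scaled_exp s f : 0 < s ->
  {in `]0, +oo[%R, continuous f} -> (forall x, 0 <= f x) ->
  (\int[mu]_(x in `]0%R, +oo[) (f x)%:E =
   \int[mu]_t (f (s * expR t) * (s * expR t))%:E)%E.
Proof.
move=> s0 cf f0.
pose F t := s * expR t.
have F0 t : 0 < F t by rewrite mulr_gt0// expR_gt0.
have F'E : derive1 F = F.
  by apply/funext => t; rewrite derive1E (@derive_val _ _ _ _ _ _ _ (is_derive_scaled_exp s t)).
have cF := @continuous_scaled_exp s.
have cfF : continuous (fun t => f (F t) * F t).
  move=> t; apply: cvgM; last exact: cF.
  apply: continuous_comp; first exact: cF.
  by apply: cf; rewrite in_itv/= andbT; exact: F0.
(* Substitute on [- n, n] and let n go to infinity: the library's rules for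
   unbounded intervals need a finite limit of F' at +oo. *)
have E n : (\int[mu]_(x in `[F (- n%:R)%R, F n%:R%R]) (f x)%:E =
    \int[mu]_(t in `[(- n%:R)%R, n%:R%R]) (f (F t) * F t)%:E)%E.
  rewrite (@integration_by_substitution_increasing _ F).
  - by rewrite F'E.
  - by rewrite (le_trans _ (ler0n _ _))// oppr_le0 ler0n.
  - by move=> x y _ _ xy; rewrite /F ltr_pM2l// ltr_expR.
  - by rewrite F'E => t _; exact: cF.
  - rewrite F'E; apply: cvgP; apply: cvg_at_right_filter; exact: cF.
  - rewrite F'E; apply: cvgP; apply: cvg_at_left_filter; exact: cF.
  - split.
    + by move=> t _; have [] := is_derive_scaled_exp s t.
    + by apply: cvg_at_right_filter; exact: cF.
    + by apply: cvg_at_left_filter; exact: cF.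
  - apply: continuous_in_subspaceT => x; rewrite inE/= in_itv/= => /andP[Fx _].
    by apply: cf; rewrite in_itv/= andbT (lt_le_trans _ Fx).
have mf : measurable_fun `](0 : R), +oo[ f.
  apply: open_continuous_measurable_fun; first exact: interval_open.
  by move=> x; rewrite inE; exact: cf.
have UF : \bigcup_n `[F (- n%:R), F n%:R]%classic = `]0, +oo[%classic.
  apply/seteqP; split=> x /=.
    by move=> [n _]/=; rewrite !in_itv/= andbT => /andP[+ _]; exact: lt_le_trans.
  rewrite in_itv/= andbT => x0.
  have xs0 : 0 < x / s by rewrite divr_gt0.
  have [n nx] : exists n : nat, `|ln (x / s)| <= n%:R.
    by exists (Num.truncn `|ln (x / s)|).+1; rewrite ltW// truncnS_gt.
  exists n => //=; rewrite in_itv/=.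
  have -> : x = F (ln (x / s)).
    by rewrite /F lnK ?posrE// mulrC divfK// gt_eqF.
  by rewrite /F !ler_pM2l// !ler_expR -ler_norml.
have UT : \bigcup_n `[- n%:R, n%:R]%classic = [set: R].
  apply/seteqP; split=> x //= _.
  exists (Num.truncn `|x|).+1 => //=.
  by rewrite in_itv/= -ler_norml ltW// truncnS_gt.
(* Monotone convergence along the two exhaustions [UF] and [UT]: by [E] the two sequences of
   integrals coincide, hence so do their limits. *)
have lhs := @ge0_nondecreasing_set_cvg_integral _ (measurableTypeR R) R
  (fun n => `[F (- n%:R), F n%:R]%classic) (EFin \o f) mu.
have rhs := @ge0_nondecreasing_set_cvg_integral _ (measurableTypeR R) R
  (fun n => `[- n%:R, n%:R]%classic) (EFin \o (fun t => f (F t) * F t)) mu.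
rewrite UF in lhs; rewrite UT in rhs.
apply: cvg_unique (lhs _ _ _ _) _ => //.
- move=> m n mn; apply/subsetPset => x /=; rewrite !in_itv/= => /andP[h1 h2].
  by rewrite (le_trans _ h1) ?(le_trans h2)// /F ler_pM2l// ler_expR ?lerN2 ler_nat.
- move=> n; apply/measurable_EFinP; apply: measurable_funS mf => //.
  by rewrite -UF => x Fx; exists n.
- by move=> n x _; rewrite lee_fin.
rewrite /=; under eq_fun do rewrite E.
apply: rhs => //.
- move=> m n mn; apply/subsetPset => x /=; rewrite !in_itv/= => /andP[h1 h2].
  by rewrite (le_trans _ h1) ?(le_trans h2) ?lerN2 ?ler_nat.
- move=> n; apply/measurable_EFinP/measurable_funTS.
  exact: continuous_measurable_fun.
- by move=> n x _; rewrite lee_fin mulr_ge0// ltW.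
Qed.

End exp_substitution.

(** * Reduction of the tail integral to the Bessel function of order 1 *)

Section besselK1.
Context {R : realType}.
Notation mu := (@lebesgue_measure R).

Lemma ge0_integralT_fold (h : R -> R) : continuous h -> (forall t, 0 <= h t) ->
  (\int[mu]_t (h t)%:E = \int[mu]_(t in `[0%R, +oo[) (h t + h (- t))%:E)%E.
Proof.
move=> ch h0.
have mh : measurable_fun [set: R] h by exact: continuous_measurable_fun.
have mhN : measurable_fun [set: R] (h \o -%R).
  by apply: continuous_measurable_fun => t; apply: continuous_comp;
    [exact: opp_continuous|exact: ch].
rewrite -(setUv `[0%R, +oo[%classic) ge0_integral_setU//=; last 4 first.
- exact: measurableC.
- by apply/measurable_EFinP; rewrite setUv.
- by move=> x _; rewrite lee_fin.
- exact/disj_setPCl.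
(* The point 0 is null, so the negative half-line may be closed there; its endpoint is then written
   [- 0] to apply the reflection of the variable. *)
rewrite setCitvr integral_itv_bndo_bndc; last exact/measurable_EFinP/measurable_funTS.
rewrite -{2}oppr0 ge0_integration_by_substitutionNy//; last exact: continuous_subspaceT.
rewrite -ge0_integralD//=.
- by move=> x _; rewrite lee_fin.
- exact/measurable_EFinP/measurable_funTS.
- by move=> x _; rewrite lee_fin.
- exact/measurable_EFinP/measurable_funTS.
Qed.

(** The scale [sqrt r] balances the two terms: [y + r / y] becomes [2 * sqrt r * cosh t], which is
    even in [t]. Folding the line at 0 then symmetrizes the Jacobian [expR t] into [2 * cosh t]. *)
Lemma integral_expR_besselK1 (r : R) : 0 < r ->
  (\int[mu]_(y in `]0%R, +oo[) (expR (- y - r / y))%:E =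
   (2 * Num.sqrt r)%:E * \int[mu]_(t in `[0%R, +oo[)
     (expR (- (2 * Num.sqrt r) * cosh t) * cosh (1 * t))%:E)%E.
Proof.
move=> r0; set s := Num.sqrt r.
have s0 : 0 < s by rewrite sqrtr_gt0.
have rE : r = s * s by rewrite -expr2 sqr_sqrtr// ltW.
pose f y : R := expR (- y - r / y).
have cf : {in `]0, +oo[%R, continuous f}.
  move=> y; rewrite in_itv/= andbT => y0.
  apply: continuous_comp; last exact: continuous_expR.
  apply: cvgB; first exact: cvgN.
  by apply: cvgMl_tmp; apply: cvgV; rewrite ?gt_eqF.
rewrite (ge0_integral_scaled_exp s0 cf)//; last by move=> x; exact: expR_ge0.
have fE t : f (s * expR t) * (s * expR t) =
    s * (expR (- (2 * s) * cosh t) * expR t).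
  rewrite mulrCA; congr (_ * (expR _ * _)).
  rewrite rE /cosh expRN; field.
  by rewrite gt_eqF ?expR_gt0// gt_eqF.
have cfs : continuous (fun t => f (s * expR t) * (s * expR t)).
  move=> t; apply: cvgM; last exact: continuous_scaled_exp.
  apply: continuous_comp; first exact: continuous_scaled_exp.
  by apply: cf; rewrite in_itv/= andbT mulr_gt0// expR_gt0.
rewrite ge0_integralT_fold//; last first.
  by move=> t; rewrite mulr_ge0// ?mulr_ge0 ?expR_ge0// ltW.
have chN (t : R) : cosh (- t) = cosh t by rewrite /cosh opprK addrC.
have E t : f (s * expR t) * (s * expR t) + f (s * expR (- t)) * (s * expR (- t))
    = (2 * s) * (expR (- (2 * s) * cosh t) * cosh (1 * t)).
  rewrite (fE t) (fE (- t)) chN mul1r.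
  by move: (expR (_ * cosh t)) => k; rewrite /cosh; field.
rewrite -ge0_integralZl//=.
- by apply: eq_integral => t _; rewrite E EFinM.
- apply/measurable_EFinP/measurable_funTS; apply: continuous_measurable_fun => t.
  have cch : continuous (@cosh R).
    move=> u; apply: cvgMr_tmp; apply: cvgD; first exact: continuous_expR.
    by apply: continuous_comp; [exact: opp_continuous|exact: continuous_expR].
  apply: cvgM; last by under eq_fun do rewrite mul1r; rewrite mul1r; exact: cch.
  by apply: continuous_comp; [apply: cvgMl_tmp; exact: cch|exact: continuous_expR].
- move=> t _; rewrite lee_fin mulr_ge0 ?expR_ge0// /cosh.
  by rewrite divr_ge0// addr_ge0 ?expR_ge0.
- by rewrite lee_fin mulr_ge0// ltW.
Qed.

Lemma Rintegral_expR_besselK1 (r : R) : 0 < r ->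
  \int[mu]_(y in `]0, +oo[) expR (- y - r / y) =
  2 * Num.sqrt r * besselK 1 (2 * Num.sqrt r).
Proof.
move=> r0; rewrite /besselK /Rintegral integral_expR_besselK1//.
have s0 : 0 < 2 * Num.sqrt r by rewrite mulr_gt0// sqrtr_gt0.
(* A positive factor keeps an infinite integral infinite and [fine] sends infinities to 0, so the
   identity passes to real integrals in every case. *)
case: (\int[_]_(_ in _) _)%E => //=.
- by rewrite gt0_muley ?lte_fin//= mulr0.
- by rewrite gt0_muleNy ?lte_fin//= mulr0.
Qed.

End besselK1.

(** * Law of the product of two independent unit exponentials *)

Section exponential_product.
Context d (T : measurableType d) (R : realType) (P : probability T R).
Notation mu := (@lebesgue_measure R).
Implicit Types X Y : {RV P >-> R}.

Lemma exponential_law_itvNyo X : has_law X (exponential_prob 1) ->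
  distribution P X `]-oo, 0%R[ = 0%E.
Proof.
move=> hX; rewrite hX// /exponential_prob integral0_eq// => x /=.
by rewrite in_itv/= => x0; rewrite lt0_exponential_pdf.
Qed.

Lemma exponential_law_itvoy X (x : R) : has_law X (exponential_prob 1) ->
  0 < x -> distribution P X `]x, +oo[ = (expR (- x))%:E.
Proof.
move=> hX x0.
(* The exponential law has a closed form on [[0, x]] and vanishes on the negatives, so the tail is
   computed through its complement. *)
have -> : `]x, +oo[%classic = ~` (`]-oo, 0%R[ `|` `[0%R, x]) :> set R.
  apply/seteqP; split=> y /=; rewrite !in_itv/= ?andbT.
    by move=> xy [|]; lra.
  move=> /not_orP[]; rewrite !ltNge => /negP; rewrite negbK => y0.
  by rewrite y0/= => /negP.
have mI : measurable (`]-oo, 0%R[ `|` `[0%R, x] : set R) by exact: measurableU.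
rewrite probability_setC// measureU//; last first.
  apply/seteqP; split => y //=; rewrite !in_itv/=; lra.
rewrite [X in (1 - (X + _))%E]exponential_law_itvNyo// add0e.
rewrite [X in (1 - X)%E]hX// exponential_prob_itv0c// mulN1r.
by rewrite -!EFinB subKr.
Qed.

(** Independence makes the joint law agree with the product on measurable rectangles, and these
    determine the product measure. *)
Lemma distribution_pair X Y (S : set (R * R)) : independent_RV X Y ->
  measurable S ->
  P ((fun w => (X w, Y w)) @^-1` S) = (distribution P X \x distribution P Y)%E S.
Proof.
move=> XY mS.
have mXY : measurable_fun [set: T] (fun w => (X w, Y w)) by exact: measurable_fun_pair.
pose Z : {mfun T >-> (R * R)%type} := HB.pack (fun w => (X w, Y w))
  (isMeasurableFun.Build _ _ _ _ _ mXY).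
by rewrite (@product_measure_unique _ _ _ _ _ _ _ (distribution P Z))//.
Qed.

(* Only the law of [Y] is unfolded as an integral before applying Fubini; that of
   [X] is then evaluated on half-lines, so no integral against a law is needed. *)
Lemma exponential_product_tail X Y (r : R) :
  has_law X (exponential_prob 1) -> has_law Y (exponential_prob 1) ->
  independent_RV X Y -> 0 < r ->
  P [set w | r < X w * Y w] =
  (\int[mu]_(y in `]0%R, +oo[) (expR (- y - r / y))%:E)%E.
Proof.
move=> hX hY XY r0.
pose S : set (R * R) := [set z | r < z.1 * z.2].
have mS : measurable S.
  have : measurable_fun [set: R * R] (fun z : R * R => r < z.1 * z.2).
    by apply: measurable_fun_ltr => //; exact: measurable_funM.
  by move=> /(_ measurableT [set true] I); rewrite setTI.
rewrite (_ : [set w | _] = (fun w => (X w, Y w)) @^-1` S)// distribution_pair//.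
pose g (z : R * R) : \bar R := ((exponential_pdf 1 z.2)%:E * (\1_S z)%:E)%E.
have mg : measurable_fun [set: R * measurableTypeR R] g.
  apply: emeasurable_funM; apply/measurable_EFinP.
    apply: measurableT_comp => //; exact: measurable_exponential_pdf.
  exact: measurable_indic.
have pdf0 (y : R) : 0 <= exponential_pdf 1 y by exact: exponential_pdf_ge0.
have g0 z : (0 <= g z)%E by rewrite mule_ge0// lee_fin.
transitivity (\int[distribution P X]_x \int[mu]_y g (x, y))%E.
  apply: eq_integral => x _ /=.
  have mSx : measurable (xsection S x) by exact: measurable_xsection.
  rewrite hY// /exponential_prob integral_mkcond.
  by apply: eq_integral => y _; rewrite epatch_indic /g/= !indicE mem_xsection.
rewrite (@fubini_tonelli _ _ _ _ R (distribution P X) mu g)//.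
transitivity (\int[mu]_y ((exponential_pdf 1 y)%:E * distribution P X (ysection S y)))%E.
  apply: eq_integral => y _; rewrite /g/= ge0_integralZl ?lee_fin//.
    rewrite -(setIT (ysection S y)) -integral_indic//; last exact: measurable_ysection.
    by congr (_ * _)%E; apply: eq_integral => x _; rewrite !indicE mem_ysection.
  apply/measurable_EFinP; have := measurable_ysection y mS.
  move=> /(measurable_indic (R := R)); rewrite (_ : \1_ _ = fun x => \1_S (x, y))//.
  by apply/funext => x; rewrite !indicE mem_ysection.
rewrite [RHS]integral_mkcond; apply: eq_integral => y _.
rewrite patchE; case: ifPn => [|].
  rewrite inE/= in_itv/= andbT => y0.
  (* For [y > 0] the section is a half-line of mass [expR (- (r / y))]; the density of [Y] supplies
     the factor [expR (- y)]. *)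
  rewrite (_ : ysection S y = `]r / y, +oo[%classic); last first.
    apply/seteqP; split => x; rewrite /ysection/= inE/= in_itv/= andbT.
      by rewrite ltr_pdivrMr.
    by rewrite ltr_pdivrMr.
  rewrite exponential_law_itvoy// ?divr_gt0// exponential_pdfE ?ltW// -EFinM.
  by rewrite mul1r mulN1r expRD.
(* At [y = 0] the density is not zero, but the section is empty since [r > 0]; for [y < 0] the
   density vanishes. *)
rewrite notin_setE/= in_itv/= andbT => /negP; rewrite -leNgt le_eqVlt => /predU1P[->|y0].
  rewrite (_ : ysection S 0 = set0) ?measure0 ?mule0//.
  apply/seteqP; split => x //; rewrite /ysection/= inE /S/= mulr0; lra.
by rewrite lt0_exponential_pdf// mul0e.
Qed.

Lemma cdf_exponential_product (X Y Z : {RV P >-> R}) (r : R) :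
  has_law X (exponential_prob 1) -> has_law Y (exponential_prob 1) ->
  independent_RV X Y -> (forall w, Z w = X w * Y w) -> 0 < r ->
  cdf Z r = (1 - 2 * Num.sqrt r * besselK 1 (2 * Num.sqrt r))%:E.
Proof.
move=> hX hY XY ZE r0.
have tailE := exponential_product_tail hX hY XY r0.
have -> : cdf Z r = P (~` [set w | r < X w * Y w]).
  rewrite /cdf /distribution /pushforward; congr (P _).
  apply/seteqP; split => w /=; rewrite in_itv/= ZE leNgt; first exact/negP.
  by move/negP.
have mtail : measurable [set w | r < X w * Y w].
  have : measurable_fun [set: T] (fun w => r < X w * Y w).
    by apply: measurable_fun_ltr => //; exact: measurable_funM.
  by move=> /(_ measurableT [set true] I); rewrite setTI.
rewrite probability_setC//.
rewrite -Rintegral_expR_besselK1// /Rintegral -tailE EFinB fineK//.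
exact: fin_num_measure.
Qed.

(** A negative product has a negative factor, and each factor is negative with probability 0. *)
Lemma exponential_product_ge0 (X Y Z : {RV P >-> R}) :
  has_law X (exponential_prob 1) -> has_law Y (exponential_prob 1) ->
  (forall w, Z w = X w * Y w) -> P [set w | Z w < 0] = 0%E.
Proof.
move=> hX hY ZE.
have mN (V : {RV P >-> R}) : measurable (V @^-1` `]-oo, 0%R[).
  by rewrite -[X in measurable X]setTI; exact: measurable_funPT.
have -> : [set w | Z w < 0] = Z @^-1` `]-oo, 0%R[.
  by apply/seteqP; split => w /=; rewrite in_itv.
apply: (@subset_measure0 _ _ _ P _ (X @^-1` `]-oo, 0%R[ `|` Y @^-1` `]-oo, 0%R[)).
- exact: mN.
- by apply: measurableU; exact: mN.
- move=> w /=; rewrite !in_itv/= ZE => XY0.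
  have [|X0] := ltP (X w) 0; first by left.
  have [|Y0] := ltP (Y w) 0; first by right.
  by move: XY0; rewrite ltNge mulr_ge0.
- apply: null_set_setU; [exact: mN|exact: mN| |]; exact: exponential_law_itvNyo.
Qed.

End exponential_product.

(** * Best port and SINR threshold *)

Section system_model.
Context {R : realType}.

Lemma best_gain_le (N : nat) (g : 'I_N -> R) (r : R) : (0 < N)%N ->
  (best_gain g <= r) = [forall n, g n <= r].
Proof.
move=> N0; rewrite /best_gain.
apply/idP/forallP => [le_r n|ge_r].
  by apply: le_trans le_r; apply: le_bigmax_cond.
apply/bigmax_leP; split=> //.
(* The initial value of the maximum is the gain of the first port, so it obeys the same bound. *)
by case: N N0 g ge_r => // N _ g ge_r; rewrite codomE enum_ordSl; exact: ge_r.
Qed.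

Lemma sinr_weak_le (snr Lp alpha dt d2 p1 p2 thr g : R) :
  0 < snr -> 0 < Lp -> 0 < dt -> 0 < d2 -> 0 <= p1 -> 0 < p2 - thr * p1 -> 0 <= g ->
  (sinr_weak snr Lp alpha dt d2 p1 p2 g <= thr) =
  (g <= gamma_tilde snr Lp alpha dt d2 p1 p2 thr).
Proof.
move=> snr0 Lp0 dt0 d20 p10 p0 g0; rewrite /sinr_weak /gamma_tilde !powRN.
have := powR_gt0 alpha dt0; have := powR_gt0 alpha d20.
move: (dt `^ alpha) (d2 `^ alpha) => a b b0 a0.
rewrite ler_pdivrMr; last first.
  by rewrite ltr_wpDl// !mulr_ge0// ?invr_ge0 ltW.
rewrite ler_pdivlMr; last by rewrite !mulr_gt0.
(* Multiplying by [a * b] clears the inverse path losses; the two inequalities then have the same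
   difference of sides. *)
have ab0 : 0 < a * b by rewrite mulr_gt0.
rewrite -(ler_pM2r ab0).
rewrite -subr_ge0 -[RHS]subr_ge0; congr (0 <= _); field.
by rewrite !gt_eqF.
Qed.

End system_model.

(** * Measurability of the events and comparison up to null sets *)

Section measurability.
Context d (T : measurableType d) (R : realType).

Lemma measurable_best_gain (N : nat) (g : 'I_N -> T -> R) : (0 < N)%N ->
  (forall n, measurable_fun [set: T] (g n)) ->
  measurable_fun [set: T] (fun w => best_gain (fun n => g n w)).
Proof.
move=> N0 mg mD; apply: (measurability _ (RGenOInfty.measurableE R)) => //.
move=> /= _ [_ [a ->] <-]; rewrite setTI.
rewrite [X in measurable X](_ : _ = ~` \bigcap_n (g n @^-1` `]-oo, a])).
  apply: measurableC; apply: fin_bigcap_measurable => // n _.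
  by rewrite -[X in measurable X]setTI; exact: mg.
apply/seteqP; split=> w /=; rewrite in_itv/= andbT ltNge best_gain_le//.
  move=> /forallP ag ga; apply: ag => n.
  by have := ga n I; rewrite /= in_itv.
move=> nga; apply/forallP => ga; apply: nga => n _ /=.
by rewrite in_itv/= ga.
Qed.

(** Clearing the denominator by its sign leaves comparisons of measurable functions; division by 0
    gives 0, hence the case [0 <= t]. The SINR denominator can have any sign at negative gains. *)
Lemma measurable_ratio_le (f g : T -> R) (t : R) :
  measurable_fun [set: T] f -> measurable_fun [set: T] g ->
  measurable [set w | f w / g w <= t].
Proof.
move=> mf mg.
have mtg : measurable_fun [set: T] (fun w => t * g w) by exact: measurable_funM.
have mc (c : R) : measurable_fun [set: T] (fun=> c) by exact: measurable_cst.
have : measurable_fun [set: T] (fun w => [|| (0 < g w) && (f w <= t * g w),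
    (g w < 0) && (t * g w <= f w) | (g w == 0) && (0 <= t)]).
  apply: measurable_or; last apply: measurable_or; apply: measurable_and => //;
  by [exact: measurable_fun_ltr|exact: measurable_fun_ler|exact: measurable_fun_eqr].
move=> /(_ measurableT [set true] I); rewrite setTI.
congr measurable; apply/funext => w; apply/propext => /=.
have [g0|g0|->] := ltgtP (g w) 0 => /=.
- by rewrite ler_ndivrMr// orbF.
- by rewrite ler_pdivrMr// orbF.
- by rewrite invr0 mulr0.
Qed.

(** Adjoining the null set changes neither measure and makes the two sets equal. *)
Lemma measure_eq_offnull (mu : {measure set T -> \bar R}) (A B N : set T) :
  measurable A -> measurable B -> measurable N -> mu N = 0%E ->
  (forall w, ~ N w -> A w <-> B w) -> mu A = mu B.
Proof.
move=> mA mB mN N0 AB.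
rewrite -(measureU0 mA mN N0) -(measureU0 mB mN N0); congr (mu _).
apply/seteqP; split => w [|]; try by right.
- by have [Nw|/AB] := pselect (N w); [right|move=> [+ _] => /[apply]; left].
- by have [Nw|/AB] := pselect (N w); [right|move=> [_ +] => /[apply]; left].
Qed.

End measurability.

Theorem theorem2 (R : realType) (d : measure_display) (T : measurableType d)
    (P : probability T R)
    (snr Lp alpha dt d2 p1 p2 thr : R)
    (hsnr : 0 < snr) (hLp : 0 < Lp) (halpha : 2 < alpha)
    (hdt : 0 < dt) (hd2 : 0 < d2)
    (hp1 : 0 <= p1) (hp2 : 0 <= p2) (hp : p1 + p2 = 1)
    (hthr : 0 < thr) (hfeasible : 0 < p2 - thr * p1)
    (N1 N2 : nat) (hN1 : (0 < N1)%N) (hN2 : (0 < N2)%N)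
    (W1 W2 : R) (hW1 : 0 < W1) (hW2 : 0 < W2)
    (port : 'I_(N1 * N2) -> 'I_N1 * 'I_N2) (hport : bijective port)
    (genergy ginfo geq : 'I_(N1 * N2) -> {RV P >-> R})
    (henergy : forall n, has_law (genergy n) (exponential_prob 1))
    (hinfo : forall n, has_law (ginfo n) (exponential_prob 1))
    (hindep : forall n, independent_RV (genergy n) (ginfo n))
    (hgeq : forall n w, geq n w = genergy n w * ginfo n w)
    (hcopula : gaussian_copula_diag (port_corr W1 W2 port) geq) :
  let gfas := fun w => best_gain (fun n => geq n w) in
  let gt := gamma_tilde snr Lp alpha dt d2 p1 p2 thr in
  let q := Num.sqrt 2 *
           erf_inv (1 - 4 * Num.sqrt gt * besselK 1 (2 * Num.sqrt gt)) in
  P [set w | sinr_weak snr Lp alpha dt d2 p1 p2 (gfas w) <= thr] =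
  mvn_cdf (port_corr W1 W2 port) (fun=> q).
Proof.
move=> gfas gt q.
have N0 : (0 < N1 * N2)%N by rewrite muln_gt0 hN1.
have gt_gt0 : 0 < gt.
  by rewrite /gt /gamma_tilde divr_gt0// !mulr_gt0// powR_gt0.
have mgfas : measurable_fun [set: T] gfas by exact: measurable_best_gain.
(* With [F = 1 - 2 * s * K] the quantile argument [2 * F - 1] is [1 - 4 * s * K], whence the
   constant 4; all ports share this marginal. *)
have quantileE : (fun n => normal_quantile (fine (cdf (geq n) gt))) = fun=> q.
  apply/funext => n.
  rewrite (cdf_exponential_product (henergy n) (hinfo n) (hindep n) (hgeq n) gt_gt0)/=.
  by rewrite /normal_quantile /q; congr (_ * erf_inv _); ring.
rewrite -quantileE -hcopula//.
have leE w : [set w | forall n, geq n w <= gt] w <-> gfas w <= gt.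
  by rewrite /gfas best_gain_le//; split => [h|/forallP//]; exact/forallP.
have mneg n : measurable [set w | geq n w < 0].
  have : measurable_fun [set: T] (fun w => geq n w < 0) by exact: measurable_fun_ltr.
  by move=> /(_ measurableT [set true] I); rewrite setTI.
(* [sinr_weak] is not monotone on negative gains, which only occur on this null set. *)
pose neg k : set T := if insub k is Some n then [set w | geq n w < 0] else set0.
(* Indices beyond the last port give the empty set, so the ports form a sequence and countable
   unions of null sets apply. *)
have neg0 k : measurable (neg k) /\ P (neg k) = 0%E.
  rewrite /neg; case: insub => [n|]; last by rewrite measure0.
  by split => //; exact: exponential_product_ge0 (henergy n) (hinfo n) (hgeq n).
have mN : measurable (\bigcup_k neg k).
  by apply: bigcupT_measurable => k; exact: (neg0 k).1.
apply: (measure_eq_offnull (N := \bigcup_k neg k)) => //.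
- by apply: measurable_ratio_le; [exact: measurable_funM|apply: measurable_funD => //;
    exact: measurable_funM].
- have : measurable_fun [set: T] (fun w => gfas w <= gt) by exact: measurable_fun_ler.
  move=> /(_ measurableT [set true] I); rewrite setTI; congr measurable.
  by apply/funext => w; apply/propext; rewrite leE.
- apply/(negligibleP P mN)/negligible_bigcup => k.
  by apply/negligibleP; have [] := neg0 k.
- move=> w Nw; rewrite leE /= sinr_weak_le//.
  have g0 n : 0 <= geq n w.
    rewrite leNgt; apply/negP => gn0; apply: Nw; exists (val n) => //.
    by rewrite /neg valK.
  (* The best gain dominates that of port 0, hence is nonnegative off the null set. *)
  apply: le_trans (g0 (Ordinal N0)) _.
  by have := lexx (gfas w); rewrite {1}/gfas best_gain_le// => /forallP.
Qed.
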